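(* Let $G$ be a finite group acting on an abelian category $\mathcal{A}$ such that the functors $Ind:\mathcal{A}\to\mathcal{A}^G$ and $\mathscr{F}:\mathcal{A}^G\to\mathcal{A}$ are exact and satisfy $Ind\dashv\mathscr{F}\dashv Ind$, and every object $(A,\varphi)\in\mathcal{A}^G$ is a direct summand of $Ind(A)$. Let $C$ be the set of $G$-invariant Serre subcategories of $\mathcal{A}$, $Esp_{Serre,G}(\mathcal{A}):=Esp_C(\mathcal{A})$ and $C^G:=\{\mathcal{S}^G:\mathcal{S}\in C\}$. Then there is an immersion $$Esp_{Serre,G}(\mathcal{A})=Esp_C(\mathcal{A})\cong Esp_{C^G}(\mathcal{A}^G)\hookrightarrow Esp_{Serre}(\mathcal{A}^G)$$ (given by $\mathcal{S}\mapsto\mathcal{S}^G$).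
   Context: An action of $G$ (identity $e$) on $\mathcal{A}$ consists of exact equivalences $T_g:\mathcal{A}\to\mathcal{A}$ ($g\in G$) and natural isomorphisms $\gamma_{g,h}:T_gT_h\to T_{gh}$ with $\gamma_{g,hk}\circ T_g\gamma_{h,k}=\gamma_{gh,k}\circ\gamma_{g,h}T_k$ for all $g,h,k$. A $G$-equivariant object is a pair $(E,\varphi)$ with $E\in\mathcal{A}$ and isomorphisms $\varphi_g:T_gE\to E$ such that $\varphi_{gh}\circ\gamma_{g,h}^E=\varphi_g\circ T_g\varphi_h$. The equivariantization $\mathcal{A}^G$ has these as objects and, as morphisms, the morphisms in $\mathcal{A}$ commuting with the $\varphi_g$'s; it is abelian, with a sequence exact iff the underlying sequence in $\mathcal{A}$ is exact. $\mathscr{F}(E,\varphi)=E$ is the forgetful functor and $Ind(A)=(\bigoplus_{g}T_gA,\tau^A)$ with $\tau^A_h=\bigoplus_g\gamma^A_{h,h^{-1}g}$. A Serre subcategory is a non-empty full additive subcategory $\mathcal{S}$ such that for each short exact sequence $0\to L\to M\to N\to0$ one has $M\in\mathcal{S}$ iff $L,N\in\mathcal{S}$. A subcategory $\mathcal{S}$ is $G$-invariant if $T_g(\mathcal{S})\subseteq\mathcal{S}$ for all $g\in G$. $\mathcal{S}^G:=\{(E,\varphi)\in\mathcal{A}^G:E\in\mathcal{S}\}$. For a set $C$ of Serre subcategories, $Esp_C$ is $C$ with the topology whose closed sets are $\{\mathcal{P}\in C:\mathcal{P}\cap\mathcal{X}=\emptyset\}$, $\mathcal{X}$ ranging over classes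 of objects. $Esp_{Serre}(\mathcal{A}^G)$ is this space for the set of all Serre subcategories of $\mathcal{A}^G$. An immersion is a homeomorphism onto its image with the subspace topology. *)

(* Defs.v *)
From HB Require Import structures.
From mathcomp Require Import all_boot all_order all_algebra all_fingroup.
From mathcomp Require Import all_classical.
From mathcomp Require Import topology.

Set Implicit Arguments.
Unset Strict Implicit.
Unset Printing Implicit Defensive.

Import GRing.Theory.
Local Open Scope classical_set_scope.
Local Open Scope ring_scope.

Reserved Notation "g \c f" (at level 40, left associativity).

Record preaddCat := PreaddCat {
  obj :> Type;
  hom : obj -> obj -> zmodType;
  idm : forall X, hom X X;
  hcomp : forall X Y Z, hom Y Z -> hom X Y -> hom X Z;
  hcompA : forall X Y Z W (h : hom Z W) (g : hom Y Z) (f : hom X Y),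
    hcomp h (hcomp g f) = hcomp (hcomp h g) f;
  hcomp1m : forall X Y (f : hom X Y), hcomp (idm Y) f = f;
  hcompm1 : forall X Y (f : hom X Y), hcomp f (idm X) = f;
  hcompDl : forall X Y Z (g g' : hom Y Z) (f : hom X Y),
    hcomp (g + g') f = hcomp g f + hcomp g' f;
  hcompDr : forall X Y Z (g : hom Y Z) (f f' : hom X Y),
    hcomp g (f + f') = hcomp g f + hcomp g f'
}.

Arguments hom {p} X Y.
Arguments idm {p} X.
Arguments hcomp {p X Y Z} g f.

Notation "g \c f" := (hcomp g f) : ring_scope.

Section Arrows.
Variable A : preaddCat.

Definition is_iso (X Y : A) (f : hom X Y) : Prop :=
  exists g : hom Y X, f \c g = idm Y /\ g \c f = idm X.

Definition isomorphic (X Y : A) : Prop := exists f : hom X Y, is_iso f.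

Definition monomor (X Y : A) (f : hom X Y) : Prop :=
  forall (W : A) (h h' : hom W X), f \c h = f \c h' -> h = h'.

Definition epimor (X Y : A) (f : hom X Y) : Prop :=
  forall (W : A) (h h' : hom Y W), h \c f = h' \c f -> h = h'.

Definition is_kernel (X Y : A) (f : hom X Y) (K : A) (k : hom K X) : Prop :=
  f \c k = 0 /\
  forall (W : A) (h : hom W X), f \c h = 0 -> exists! u : hom W K, k \c u = h.

Definition is_cokernel (X Y : A) (f : hom X Y) (Q : A) (q : hom Y Q) : Prop :=
  q \c f = 0 /\
  forall (W : A) (h : hom Y W), h \c f = 0 -> exists! u : hom Q W, u \c q = h.

Definition short_exact (L M N : A) (f : hom L M) (g : hom M N) : Prop :=
  is_kernel g f /\ is_cokernel f g.

End Arrows.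

(* [bip F] is a chosen biproduct of the finite family [F]; the empty family
   gives the zero object. *)
Record abCat := AbCat {
  acat :> preaddCat;
  bip : forall I : finType, (I -> acat) -> acat;
  binj : forall (I : finType) (F : I -> acat) (i : I), hom (F i) (bip F);
  bproj : forall (I : finType) (F : I -> acat) (i : I), hom (bip F) (F i);
  bprojK : forall (I : finType) (F : I -> acat) (i : I),
    bproj F i \c binj F i = idm (F i);
  bproj0 : forall (I : finType) (F : I -> acat) (i j : I),
    i != j -> bproj F i \c binj F j = 0;
  bip_id : forall (I : finType) (F : I -> acat),
    \sum_(i : I) binj F i \c bproj F i = idm (bip F);
  ker_ex : forall (X Y : acat) (f : hom X Y),
    exists (K : acat) (k : hom K X), is_kernel f k;
  coker_ex : forall (X Y : acat) (f : hom X Y),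
    exists (Q : acat) (q : hom Y Q), is_cokernel f q;
  mono_normal : forall (X Y : acat) (f : hom X Y),
    monomor f -> exists (Z : acat) (g : hom Y Z), is_kernel g f;
  epi_normal : forall (X Y : acat) (f : hom X Y),
    epimor f -> exists (Z : acat) (g : hom Z X), is_cokernel g f
}.

Definition dsum (A : abCat) (X Y : A) : A :=
  bip (fun b : bool => if b then X else Y).

Definition direct_summand (A : abCat) (X M : A) : Prop :=
  exists B : A, isomorphic M (dsum X B).

Record functor (A B : preaddCat) := Functor {
  fobj :> A -> B;
  fmap : forall X Y : A, hom X Y -> hom (fobj X) (fobj Y);
  fmap1 : forall X : A, fmap (idm X) = idm (fobj X);
  fmapM : forall (X Y Z : A) (g : hom Y Z) (f : hom X Y),
    fmap (g \c f) = fmap g \c fmap f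
}.

Arguments fmap {A B} F {X Y} f : rename.

Section Functors.
Variables A B C : preaddCat.

Definition idF : functor A A :=
  @Functor A A (fun X => X) (fun _ _ f => f)
    (fun _ => erefl) (fun _ _ _ _ _ => erefl).

Lemma compF1 (G : functor B C) (F : functor A B) (X : A) :
  fmap G (fmap F (idm X)) = idm (G (F X)).
Proof. by rewrite !fmap1. Qed.

Lemma compFM (G : functor B C) (F : functor A B) (X Y Z : A)
    (g : hom Y Z) (f : hom X Y) :
  fmap G (fmap F (g \c f)) = fmap G (fmap F g) \c fmap G (fmap F f).
Proof. by rewrite !fmapM. Qed.

Definition compF (G : functor B C) (F : functor A B) : functor A C :=
  @Functor A C (fun X => G (F X)) (fun _ _ f => fmap G (fmap F f))
    (compF1 G F) (compFM G F).

Definition nat_isomorphic (F G : functor A B) : Prop :=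
  exists2 eta : forall X, hom (F X) (G X),
    (forall (X Y : A) (f : hom X Y), eta Y \c fmap F f = fmap G f \c eta X)
    & (forall X, is_iso (eta X)).

Definition additive_functor (F : functor A B) : Prop :=
  forall (X Y : A) (f f' : hom X Y), fmap F (f + f') = fmap F f + fmap F f'.

Definition exact_functor (F : functor A B) : Prop :=
  additive_functor F /\
  forall (L M N : A) (f : hom L M) (g : hom M N),
    short_exact f g -> short_exact (fmap F f) (fmap F g).

End Functors.

Definition equivalence (A B : preaddCat) (F : functor A B) : Prop :=
  exists U : functor B A,
    nat_isomorphic (compF U F) (idF A) /\ nat_isomorphic (compF F U) (idF B).

Definition adjoint (A B : preaddCat) (L : functor A B) (R : functor B A) :
    Prop :=
  exists phi : forall (X : A) (Y : B), hom (L X) Y -> hom X (R Y),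
    [/\ forall X Y, bijective (phi X Y),
        forall (X X' : A) (Y : B) (a : hom X' X) (f : hom (L X) Y),
          phi X' Y (f \c fmap L a) = phi X Y f \c a
      & forall (X : A) (Y Y' : B) (b : hom Y Y') (f : hom (L X) Y),
          phi X Y' (b \c f) = fmap R b \c phi X Y f].

Section BasicLemmas.
Variable A : preaddCat.

Lemma hcomp0m (X Y Z : A) (f : hom X Y) : (0 : hom Y Z) \c f = 0.
Proof. by apply: (@addIr _ (0 \c f)); rewrite -hcompDl !add0r. Qed.

Lemma hcompm0 (X Y Z : A) (f : hom Y Z) : f \c (0 : hom X Y) = 0.
Proof. by apply: (@addIr _ (f \c 0)); rewrite -hcompDr !add0r. Qed.

Lemma hcompNl (X Y Z : A) (g : hom Y Z) (f : hom X Y) : (- g) \c f = - (g \c f).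
Proof. by apply/eqP; rewrite -addr_eq0 -hcompDl addNr hcomp0m. Qed.

Lemma hcompNr (X Y Z : A) (g : hom Y Z) (f : hom X Y) : g \c (- f) = - (g \c f).
Proof. by apply/eqP; rewrite -addr_eq0 -hcompDr addNr hcompm0. Qed.

Lemma hcomp_suml (I : finType) (X Y Z : A) (g : I -> hom Y Z) (f : hom X Y) :
  (\sum_i g i) \c f = \sum_i g i \c f.
Proof.
apply: (big_morph (fun g => g \c f)) => [g1 g2|]; first by rewrite hcompDl.
by rewrite hcomp0m.
Qed.

Lemma hcomp_sumr (I : finType) (X Y Z : A) (g : hom Y Z) (f : I -> hom X Y) :
  g \c (\sum_i f i) = \sum_i g \c f i.
Proof.
apply: (big_morph (fun f => g \c f)) => [f1 f2|]; first by rewrite hcompDr.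
by rewrite hcompm0.
Qed.

Definition isoinv (X Y : A) (f : hom X Y) (H : is_iso f) : hom Y X :=
  projT1 (cid H).

Lemma isoinvK (X Y : A) (f : hom X Y) (H : is_iso f) : f \c isoinv H = idm Y.
Proof. by rewrite /isoinv; case: (cid H) => g []. Qed.

Lemma isoKinv (X Y : A) (f : hom X Y) (H : is_iso f) : isoinv H \c f = idm X.
Proof. by rewrite /isoinv; case: (cid H) => g []. Qed.

Lemma iso_mono (X Y : A) (f : hom X Y) : is_iso f -> monomor f.
Proof.
move=> [g [_ gf]] W h h' E.
by rewrite -(hcomp1m h) -(hcomp1m h') -gf -!hcompA E.
Qed.

Lemma iso_epi (X Y : A) (f : hom X Y) : is_iso f -> epimor f.
Proof.
move=> [g [fg _]] W h h' E.
by rewrite -(hcompm1 h) -(hcompm1 h') -fg !hcompA E.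
Qed.

Lemma iso_id (X : A) : is_iso (idm X).
Proof. by exists (idm X); rewrite hcomp1m. Qed.

Lemma iso_comp (X Y Z : A) (g : hom Y Z) (f : hom X Y) :
  is_iso g -> is_iso f -> is_iso (g \c f).
Proof.
move=> [g' [gg' g'g]] [f' [ff' f'f]]; exists (f' \c g'); split.
  by rewrite -hcompA (hcompA f) ff' hcomp1m gg'.
by rewrite -hcompA (hcompA g') g'g hcomp1m f'f.
Qed.

Lemma ker_mono (X Y K : A) (f : hom X Y) (k : hom K X) :
  is_kernel f k -> monomor k.
Proof.
move=> [fk H] W h h' E.
have [|u [_ uniq]] := H W (k \c h'); first by rewrite hcompA fk hcomp0m.
by rewrite -(uniq h E) (uniq h' erefl).
Qed.

Lemma coker_epi (X Y Q : A) (f : hom X Y) (q : hom Y Q) :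
  is_cokernel f q -> epimor q.
Proof.
move=> [qf H] W h h' E.
have [|u [_ uniq]] := H W (h' \c q); first by rewrite -hcompA qf hcompm0.
by rewrite -(uniq h E) (uniq h' erefl).
Qed.

Lemma mono0 (X Y : A) (f : hom X Y) :
  (forall (W : A) (h : hom W X), f \c h = 0 -> h = 0) -> monomor f.
Proof.
move=> H W h h' E; apply/eqP; rewrite -subr_eq0; apply/eqP/H.
by rewrite hcompDr hcompNr E subrr.
Qed.

Lemma epi0 (X Y : A) (f : hom X Y) :
  (forall (W : A) (h : hom Y W), h \c f = 0 -> h = 0) -> epimor f.
Proof.
move=> H W h h' E; apply/eqP; rewrite -subr_eq0; apply/eqP/H.
by rewrite hcompDl hcompNl E subrr.
Qed.

Lemma ker_iso (X Y K K' : A) (f : hom X Y) (k : hom K X) (k' : hom K' X) :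
  is_kernel f k -> is_kernel f k' -> exists2 u : hom K K', k' \c u = k & is_iso u.
Proof.
move=> Hk Hk'; have [fk Uk] := Hk; have [fk' Uk'] := Hk'.
have [u [ku _]] := Uk' _ _ fk; have [v [kv _]] := Uk _ _ fk'.
exists u => //; exists v; split.
  by apply: (ker_mono Hk'); rewrite hcompA ku kv hcompm1.
by apply: (ker_mono Hk); rewrite hcompA kv ku hcompm1.
Qed.

Lemma coker_iso (X Y Q Q' : A) (f : hom X Y) (q : hom Y Q) (q' : hom Y Q') :
  is_cokernel f q -> is_cokernel f q' ->
  exists2 u : hom Q Q', u \c q = q' & is_iso u.
Proof.
move=> Hq Hq'; have [fq Uq] := Hq; have [fq' Uq'] := Hq'.
have [u [qu _]] := Uq _ _ fq'; have [v [qv _]] := Uq' _ _ fq.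
exists u => //; exists v; split.
  by apply: (coker_epi Hq'); rewrite -hcompA qv qu hcomp1m.
by apply: (coker_epi Hq); rewrite -hcompA qu qv hcomp1m.
Qed.

Lemma ker_precomp (X Y K K' : A) (f : hom X Y) (k : hom K X) (u : hom K' K) :
  is_kernel f k -> is_iso u -> is_kernel f (k \c u).
Proof.
move=> Hk Hu; have [fk Uk] := Hk; split; first by rewrite hcompA fk hcomp0m.
move=> W h fh; have [w [kw _]] := Uk _ _ fh; exists (isoinv Hu \c w); split.
  by rewrite -hcompA (hcompA u) isoinvK hcomp1m.
move=> w' E; apply: (iso_mono Hu); rewrite hcompA isoinvK hcomp1m.
by apply: (ker_mono Hk); rewrite hcompA E.
Qed.

Lemma coker_postcomp (X Y Q Q' : A) (f : hom X Y) (q : hom Y Q) (u : hom Q Q') :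
  is_cokernel f q -> is_iso u -> is_cokernel f (u \c q).
Proof.
move=> Hq Hu; have [fq Uq] := Hq; split; first by rewrite -hcompA fq hcompm0.
move=> W h fh; have [w [qw _]] := Uq _ _ fh; exists (w \c isoinv Hu); split.
  by rewrite -hcompA (hcompA _ u) isoKinv hcomp1m.
move=> w' E; apply: (iso_epi Hu); rewrite -hcompA isoKinv hcompm1.
by apply: (coker_epi Hq); rewrite -hcompA E.
Qed.

Lemma ker_transport (X Y X' Y' K : A) (f : hom X Y) (f' : hom X' Y')
    (a : hom X X') (b : hom Y Y') (k : hom K X) :
  b \c f = f' \c a -> is_iso a -> is_iso b ->
  is_kernel f k -> is_kernel f' (a \c k).
Proof.
move=> sq Ha Hb Hk; have [fk Uk] := Hk.
split; first by rewrite hcompA -sq -hcompA fk hcompm0.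
move=> W h fh.
have [|w [kw uw]] := Uk _ (isoinv Ha \c h).
  apply: (iso_mono Hb).
  by rewrite hcompA sq -hcompA (hcompA a) isoinvK hcomp1m fh hcompm0.
exists w; split; first by rewrite -hcompA kw hcompA isoinvK hcomp1m.
by move=> w' E; apply: uw; rewrite -E !hcompA isoKinv hcomp1m.
Qed.

Lemma coker_transport (X Y X' Y' Q : A) (f : hom X Y) (f' : hom X' Y')
    (a : hom X' X) (b : hom Y' Y) (q : hom Y Q) :
  b \c f' = f \c a -> is_iso a -> is_iso b ->
  is_cokernel f q -> is_cokernel f' (q \c b).
Proof.
move=> sq Ha Hb Hq; have [fq Uq] := Hq.
split; first by rewrite -hcompA sq hcompA fq hcomp0m.
move=> W h fh.
have [|w [qw uw]] := Uq _ (h \c isoinv Hb).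
  apply: (iso_epi Ha).
  by rewrite -hcompA -sq -!hcompA (hcompA _ b) isoKinv hcomp1m fh hcomp0m.
exists w; split; first by rewrite hcompA qw -hcompA isoKinv hcompm1.
by move=> w' E; apply: uw; rewrite -E -!hcompA isoinvK hcompm1.
Qed.

Lemma ker_coker (X Y K Q : A) (f : hom X Y) (k : hom K X) (q : hom X Q) :
  is_kernel f k -> is_cokernel k q -> is_kernel q k.
Proof.
move=> [fk Uk] [qk Uq]; split=> // W h qh.
have [v [vq _]] := Uq _ _ fk.
by apply: Uk; rewrite -vq -hcompA qh hcompm0.
Qed.

Lemma coker_ker (X Y K Q : A) (f : hom X Y) (q : hom Y Q) (k : hom K Y) :
  is_cokernel f q -> is_kernel q k -> is_cokernel k q.
Proof.
move=> [qf Uq] [qk Uk]; split=> // W h hk.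
have [v [kv _]] := Uk _ _ qf.
by apply: Uq; rewrite -kv hcompA hk hcomp0m.
Qed.

End BasicLemmas.

Section Biproducts.
Variable A : abCat.

Lemma bproj_binj (I : finType) (F : I -> A) (i : I) (Y : A)
    (f : forall j, hom Y (F j)) :
  bproj F i \c (\sum_j binj F j \c f j) = f i.
Proof.
rewrite hcomp_sumr (bigD1 i) //= big1 => [|j ji].
  by rewrite addr0 hcompA bprojK hcomp1m.
by rewrite hcompA bproj0 1?eq_sym // hcomp0m.
Qed.

Lemma bip_ext (I : finType) (F : I -> A) (Y : A) (f g : hom Y (bip F)) :
  (forall i, bproj F i \c f = bproj F i \c g) -> f = g.
Proof.
move=> E; rewrite -(hcomp1m f) -(hcomp1m g) -bip_id !hcomp_suml.
by apply: eq_bigr => i _; rewrite -!hcompA E.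
Qed.

Lemma dsum_short_exact (X Y : A) :
  exists (f : hom X (dsum X Y)) (g : hom (dsum X Y) Y), short_exact f g.
Proof.
pose F := fun b : bool => if b then X else Y.
pose i1 : hom X (dsum X Y) := binj F true.
pose i2 : hom Y (dsum X Y) := binj F false.
pose p1 : hom (dsum X Y) X := bproj F true.
pose p2 : hom (dsum X Y) Y := bproj F false.
have p1i1 : p1 \c i1 = idm X by exact: (bprojK F true).
have p2i2 : p2 \c i2 = idm Y by exact: (bprojK F false).
have p2i1 : p2 \c i1 = 0 by exact: (@bproj0 _ _ F false true).
have sumE : i1 \c p1 + i2 \c p2 = idm (dsum X Y).
  by rewrite -(bip_id F) big_bool.
exists i1, p2; split; split=> // W h Hh.
- exists (p1 \c h); split; last by move=> u <-; rewrite hcompA p1i1 hcomp1m.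
  have := congr1 (fun z => z \c h) sumE.
  by rewrite hcompDl hcomp1m -!hcompA Hh hcompm0 addr0.
- exists (h \c i2); split; last by move=> u <-; rewrite -hcompA p2i2 hcompm1.
  have := congr1 (fun z => h \c z) sumE.
  by rewrite hcompDr hcompm1 !hcompA Hh hcomp0m add0r.
Qed.

End Biproducts.

Section FunctorLemmas.
Variables (A B : preaddCat) (F : functor A B).

Lemma fmap0 (X Y : A) : additive_functor F -> fmap F (0 : hom X Y) = 0.
Proof. by move=> aF; apply: (@addIr _ (fmap F 0)); rewrite -aF !add0r. Qed.

Lemma fmapN (X Y : A) (f : hom X Y) :
  additive_functor F -> fmap F (- f) = - fmap F f.
Proof.
by move=> aF; apply/eqP; rewrite -addr_eq0 -aF addNr fmap0.
Qed.

Lemma fmap_sum (I : finType) (X Y : A) (f : I -> hom X Y) :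
  additive_functor F -> fmap F (\sum_i f i) = \sum_i fmap F (f i).
Proof. by move=> aF; apply: (big_morph _ (aF X Y)); exact: fmap0. Qed.

Lemma fmap_iso (X Y : A) (f : hom X Y) : is_iso f -> is_iso (fmap F f).
Proof. by move=> [g [fg gf]]; exists (fmap F g); rewrite -!fmapM fg gf !fmap1. Qed.

Hypothesis eF : equivalence F.

Lemma equiv_faithful (X Y : A) (f f' : hom X Y) :
  fmap F f = fmap F f' -> f = f'.
Proof.
case: eF => U [[eta nat iso] _] E; apply: (iso_epi (iso X)).
by have := nat _ _ f; have := nat _ _ f'; rewrite /= E => <- <-.
Qed.

Lemma equiv_surj (W : B) : exists (V : A) (e : hom (F V) W), is_iso e.
Proof. by case: eF => U [_ [eps _ iso]]; exists (U W), (eps W); exact: iso. Qed.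
End FunctorLemmas.

Lemma equiv_full (A B : preaddCat) (F : functor A B) : equivalence F ->
  forall (X Y : A) (g : hom (F X) (F Y)), exists f : hom X Y, fmap F f = g.
Proof.
move=> [U [UF FU]] X Y g; have eU : equivalence U by exists F.
case: UF => eta nat iso.
exists (eta Y \c fmap U g \c isoinv (iso X)); apply: (equiv_faithful eU).
apply: (iso_mono (iso Y)); have /= -> := nat _ _ (eta Y \c fmap U g \c isoinv (iso X)).
by rewrite -hcompA isoKinv hcompm1.
Qed.

Section EquivalenceLemmas.
Variables (A B : preaddCat) (F : functor A B).
Hypotheses (eF : equivalence F) (aF : additive_functor F).

Lemma equiv_ker (X Y K : A) (f : hom X Y) (k : hom K X) :
  is_kernel f k -> is_kernel (fmap F f) (fmap F k).
Proof.
move=> Hk; have [fk Uk] := Hk; split; first by rewrite -fmapM fk fmap0.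
move=> W h fh; have [V [e He]] := equiv_surj eF W.
have [h' Eh'] := equiv_full eF (h \c e).
have fh' : f \c h' = 0.
  by apply: (equiv_faithful eF); rewrite fmapM Eh' hcompA fh hcomp0m fmap0.
have [u [ku _]] := Uk _ _ fh'; exists (fmap F u \c isoinv He); split.
  by rewrite hcompA -fmapM ku Eh' -hcompA isoinvK hcompm1.
move=> v Ev; have [w Ew] := equiv_full eF (v \c e).
apply: (iso_epi He); rewrite -hcompA isoKinv hcompm1 -Ew; congr (fmap F _).
apply: (ker_mono Hk); rewrite ku; apply: (equiv_faithful eF).
by rewrite fmapM Ew hcompA Ev Eh'.
Qed.

Lemma equiv_coker (X Y Q : A) (f : hom X Y) (q : hom Y Q) :
  is_cokernel f q -> is_cokernel (fmap F f) (fmap F q).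
Proof.
move=> Hq; have [qf Uq] := Hq; split; first by rewrite -fmapM qf fmap0.
move=> W h fh; have [V [e He]] := equiv_surj eF W.
pose e' := isoinv He.
have [h' Eh'] := equiv_full eF (e' \c h).
have fh' : h' \c f = 0.
  by apply: (equiv_faithful eF); rewrite fmapM Eh' -hcompA fh hcompm0 fmap0.
have [u [qu _]] := Uq _ _ fh'; exists (e \c fmap F u); split.
  by rewrite -hcompA -fmapM qu Eh' hcompA isoinvK hcomp1m.
move=> v Ev; have [w Ew] := equiv_full eF (e' \c v).
suff -> : u = w by rewrite Ew hcompA isoinvK hcomp1m.
apply: (coker_epi Hq); rewrite qu; apply: (equiv_faithful eF).
by rewrite fmapM Ew -hcompA Ev Eh'.
Qed.

End EquivalenceLemmas.

(* Canonical isomorphism [T_g X -> T_h X] attached to an equality [g = h] of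
   group elements; it is the identity, up to the equality. *)
Definition transp (I : Type) (A B : preaddCat) (T : I -> functor A B)
    (g h : I) (e : g = h) (X : A) : hom (T g X) (T h X) :=
  match e in _ = h return hom (T g X) (T h X) with erefl => idm (T g X) end.

(* The group is the whole carrier [gT]. In [gam_assoc] the two composites end
   in [T_(g(hk))] and [T_((gh)k)], which [transp] identifies. *)
Record gaction (gT : finGroupType) (A : abCat) := GAction {
  act :> gT -> functor A A;
  act_equiv : forall g, equivalence (act g);
  act_exact : forall g, exact_functor (act g);
  gam : forall (g h : gT) (X : A), hom (act g (act h X)) (act (g * h)%g X);
  gam_iso : forall (g h : gT) (X : A), is_iso (gam g h X);
  gam_nat : forall (g h : gT) (X Y : A) (f : hom X Y),
    gam g h Y \c fmap (act g) (fmap (act h) f)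
    = fmap (act (g * h)%g) f \c gam g h X;
  gam_assoc : forall (g h k : gT) (X : A),
    transp act (mulgA g h k) X \c gam g (h * k)%g X \c fmap (act g) (gam h k X)
    = gam (g * h)%g k X \c gam g h (act k X)
}.

Section Equivariantization.
Variables (gT : finGroupType) (A : abCat) (T : gaction gT A).

Record eqv_obj := EqvObj {
  eobj : A;
  ephi : forall g : gT, hom (T g eobj) eobj;
  ephi_iso : forall g, is_iso (ephi g);
  ephi_comp : forall g h : gT,
    ephi (g * h)%g \c gam T g h eobj = ephi g \c fmap (T g) (ephi h)
}.

Definition equivariant (E E' : eqv_obj) : {pred hom (eobj E) (eobj E')} :=
  fun f => `[< forall g, f \c ephi E g = ephi E' g \c fmap (T g) f >].
Arguments equivariant : clear implicits.

Lemma act_add (g : gT) : additive_functor (T g).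
Proof. exact: (proj1 (act_exact T g)). Qed.

Lemma equivariantP (E E' : eqv_obj) (f : hom (eobj E) (eobj E')) :
  reflect (forall g, f \c ephi E g = ephi E' g \c fmap (T g) f)
          (f \in equivariant E E').
Proof. exact: asboolP. Qed.

Lemma equivariant_zmod (E E' : eqv_obj) : zmod_closed (equivariant E E').
Proof.
split=> [|f f' /equivariantP Hf /equivariantP Hf']; apply/equivariantP => g.
  by rewrite hcomp0m fmap0 ?hcompm0 //; exact: act_add.
rewrite act_add fmapN; last exact: act_add.
by rewrite hcompDl hcompDr hcompNl hcompNr Hf Hf'.
Qed.

HB.instance Definition _ (E E' : eqv_obj) :=
  GRing.isZmodClosed.Build (hom (eobj E) (eobj E')) (equivariant E E')
    (@equivariant_zmod E E').

Record eqv_hom (E E' : eqv_obj) := EqvHom {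
  ehom : hom (eobj E) (eobj E');
  ehomP : ehom \in equivariant E E'
}.

HB.instance Definition _ (E E' : eqv_obj) := [isSub for @ehom E E'].
HB.instance Definition _ (E E' : eqv_obj) :=
  [Choice of eqv_hom E E' by <:].
HB.instance Definition _ (E E' : eqv_obj) :=
  [SubChoice_isSubZmodule of eqv_hom E E' by <:].

Lemma ehom_inj (E E' : eqv_obj) (f f' : eqv_hom E E') :
  ehom f = ehom f' -> f = f'.
Proof. exact: val_inj. Qed.

Lemma ehomE (E E' : eqv_obj) (f : eqv_hom E E') (g : gT) :
  ehom f \c ephi E g = ephi E' g \c fmap (T g) (ehom f).
Proof. exact: (elimT (equivariantP _) (ehomP f)). Qed.

Lemma eqv_id_subproof (E : eqv_obj) : idm (eobj E) \in equivariant E E.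
Proof. by apply/equivariantP => g; rewrite hcomp1m fmap1 hcompm1. Qed.

Definition eqv_id (E : eqv_obj) : eqv_hom E E := EqvHom (eqv_id_subproof E).

Lemma eqv_comp_subproof (E1 E2 E3 : eqv_obj) (g : eqv_hom E2 E3)
    (f : eqv_hom E1 E2) : ehom g \c ehom f \in equivariant E1 E3.
Proof.
by apply/equivariantP => a; rewrite fmapM hcompA -ehomE -!hcompA ehomE.
Qed.

Definition eqv_comp (E1 E2 E3 : eqv_obj) (g : eqv_hom E2 E3)
  (f : eqv_hom E1 E2) : eqv_hom E1 E3 := EqvHom (eqv_comp_subproof g f).

Lemma eqv_compA (X Y Z W : eqv_obj) (h : eqv_hom Z W) (g : eqv_hom Y Z)
  (f : eqv_hom X Y) :
  eqv_comp h (eqv_comp g f) = eqv_comp (eqv_comp h g) f.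
Proof. by apply: ehom_inj; exact: hcompA. Qed.

Lemma eqv_comp1m (X Y : eqv_obj) (f : eqv_hom X Y) : eqv_comp (eqv_id Y) f = f.
Proof. by apply: ehom_inj; exact: hcomp1m. Qed.

Lemma eqv_compm1 (X Y : eqv_obj) (f : eqv_hom X Y) : eqv_comp f (eqv_id X) = f.
Proof. by apply: ehom_inj; exact: hcompm1. Qed.

Lemma eqv_compDl (X Y Z : eqv_obj) (g g' : eqv_hom Y Z) (f : eqv_hom X Y) :
  eqv_comp (g + g') f = eqv_comp g f + eqv_comp g' f.
Proof. by apply: ehom_inj; exact: hcompDl. Qed.

Lemma eqv_compDr (X Y Z : eqv_obj) (g : eqv_hom Y Z) (f f' : eqv_hom X Y) :
  eqv_comp g (f + f') = eqv_comp g f + eqv_comp g f'.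
Proof. by apply: ehom_inj; exact: hcompDr. Qed.

Definition eqv_preadd : preaddCat :=
  @PreaddCat eqv_obj (fun E E' => eqv_hom E E' : zmodType) eqv_id eqv_comp
    eqv_compA eqv_comp1m eqv_compm1 eqv_compDl eqv_compDr.

Section EqvBiproduct.
Variables (I : finType) (F : I -> eqv_obj).
Let F0 (i : I) : A := eobj (F i).

Definition ebip_phi (g : gT) : hom (T g (bip F0)) (bip F0) :=
  \sum_i binj F0 i \c (ephi (F i) g \c fmap (T g) (bproj F0 i)).

Lemma ebip_phiE (g : gT) (i : I) :
  bproj F0 i \c ebip_phi g = ephi (F i) g \c fmap (T g) (bproj F0 i).
Proof. exact: bproj_binj. Qed.

Lemma ebip_phiE' (g : gT) (i : I) :
  ebip_phi g \c fmap (T g) (binj F0 i) = binj F0 i \c ephi (F i) g.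
Proof.
apply: bip_ext => j.
rewrite !hcompA ebip_phiE -[_ \c fmap _ (binj _ _)]hcompA -fmapM.
have [->|ji] := eqVneq j i; first by rewrite !bprojK fmap1 hcompm1 hcomp1m.
by rewrite !bproj0 // fmap0 ?hcompm0 ?hcomp0m //; exact: act_add.
Qed.

Lemma ebip_phi_iso (g : gT) : is_iso (ebip_phi g).
Proof.
exists (\sum_i fmap (T g) (binj F0 i) \c isoinv (ephi_iso (F i) g) \c bproj F0 i).
split.
  rewrite hcomp_sumr -bip_id; apply: eq_bigr => i _.
  by rewrite !hcompA ebip_phiE' -(hcompA (binj _ _)) isoinvK hcompm1.
rewrite hcomp_suml -fmap1 -bip_id fmap_sum; last exact: act_add.
apply: eq_bigr => i _; rewrite -!hcompA ebip_phiE (hcompA (isoinv _)) isoKinv.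
by rewrite hcomp1m fmapM.
Qed.

Lemma ebip_phi_comp (g h : gT) :
  ebip_phi (g * h)%g \c gam T g h (bip F0) = ebip_phi g \c fmap (T g) (ebip_phi h).
Proof.
apply: bip_ext => i; rewrite !hcompA !ebip_phiE -!hcompA -gam_nat -fmapM ebip_phiE.
by rewrite hcompA ephi_comp fmapM !hcompA.
Qed.

Definition ebip : eqv_obj := EqvObj ebip_phi_iso ebip_phi_comp.

Lemma ebinj_subproof (i : I) : binj F0 i \in equivariant (F i) ebip.
Proof. by apply/equivariantP => g /=; rewrite ebip_phiE'. Qed.

Definition ebinj (i : I) : eqv_hom (F i) ebip := EqvHom (ebinj_subproof i).

Lemma ebproj_subproof (i : I) : bproj F0 i \in equivariant ebip (F i).
Proof. by apply/equivariantP => g /=; rewrite ebip_phiE. Qed.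

Definition ebproj (i : I) : eqv_hom ebip (F i) := EqvHom (ebproj_subproof i).

Lemma ebprojK (i : I) : eqv_comp (ebproj i) (ebinj i) = eqv_id (F i).
Proof. by apply: ehom_inj; exact: bprojK. Qed.

Lemma ebproj0 (i j : I) : i != j -> eqv_comp (ebproj i) (ebinj j) = 0.
Proof. by move=> ij; apply: ehom_inj; exact: bproj0. Qed.

Lemma ebip_id : \sum_(i : I) eqv_comp (ebinj i) (ebproj i) = eqv_id ebip.
Proof.
apply: ehom_inj; rewrite (big_morph (@ehom _ _) (id1 := 0) (op1 := +%R)) //.
exact: bip_id.
Qed.

End EqvBiproduct.

Lemma eqv_ker_reflect (E E' K : eqv_obj) (f : eqv_hom E E') (k : eqv_hom K E) :
  is_kernel (ehom f) (ehom k) -> @is_kernel eqv_preadd E E' f K k.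
Proof.
move=> Hk; have [fk Uk] := Hk; split; first exact: ehom_inj.
move=> W h fh; have [u [ku uu]] := Uk _ _ (congr1 (@ehom _ _) fh).
have Hu : u \in equivariant W K.
  apply/equivariantP => g; apply: (ker_mono Hk).
  by rewrite !hcompA ku ehomE -ku fmapM ehomE hcompA.
exists (EqvHom Hu); split; first exact: ehom_inj.
by move=> v Ev; apply: ehom_inj; apply: uu; rewrite -Ev.
Qed.

Lemma eqv_coker_reflect (E E' Q : eqv_obj) (f : eqv_hom E E')
    (q : eqv_hom E' Q) :
  is_cokernel (ehom f) (ehom q) -> @is_cokernel eqv_preadd E E' f Q q.
Proof.
move=> Hq; have [qf Uq] := Hq; split; first exact: ehom_inj.
move=> W h fh; have [u [qu uu]] := Uq _ _ (congr1 (@ehom _ _) fh).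
have Hu : u \in equivariant Q W.
  apply/equivariantP => g.
  have Hq' := equiv_coker (act_equiv T g) (act_add g) Hq.
  apply: (coker_epi Hq').
  by rewrite -!hcompA -fmapM qu -!ehomE hcompA qu ehomE.
exists (EqvHom Hu); split; first exact: ehom_inj.
by move=> v Ev; apply: ehom_inj; apply: uu; rewrite -Ev.
Qed.

Lemma eqv_ker_lift (E E' : eqv_obj) (f : eqv_hom E E') :
  exists (K : eqv_obj) (k : eqv_hom K E), is_kernel (ehom f) (ehom k).
Proof.
have [K [k Hk]] := ker_ex (ehom f).
have Hu g : exists2 u : hom (T g K) K,
    k \c u = ephi E g \c fmap (T g) k & is_iso u.
  apply: (@ker_iso _ _ _ _ _ (ehom f)) => //.
  apply: ker_transport (equiv_ker (act_equiv T g) (act_add g) Hk).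
  - exact/esym/ehomE.
  - exact: ephi_iso.
  - exact: ephi_iso.
pose u g := projT1 (cid2 (Hu g)).
have ku g : k \c u g = ephi E g \c fmap (T g) k by rewrite /u; case: cid2.
have iu g : is_iso (u g) by rewrite /u; case: cid2.
have cu g h : u (g * h)%g \c gam T g h K = u g \c fmap (T g) (u h).
  apply: (ker_mono Hk); rewrite !hcompA !ku -!hcompA -gam_nat -fmapM ku.
  by rewrite hcompA ephi_comp fmapM !hcompA.
have Hk' : k \in equivariant (EqvObj iu cu) E by apply/equivariantP.
by exists (EqvObj iu cu), (EqvHom Hk').
Qed.

Lemma eqv_coker_lift (E E' : eqv_obj) (f : eqv_hom E E') :
  exists (Q : eqv_obj) (q : eqv_hom E' Q), is_cokernel (ehom f) (ehom q).
Proof.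
have [Q [q Hq]] := coker_ex (ehom f).
have Tq g := equiv_coker (act_equiv T g) (act_add g) Hq.
have Hu g : exists2 u : hom (T g Q) Q,
    u \c fmap (T g) q = q \c ephi E' g & is_iso u.
  apply: (coker_iso (Tq g)).
  apply: coker_transport Hq.
  - exact/esym/ehomE.
  - exact: ephi_iso.
  - exact: ephi_iso.
pose u g := projT1 (cid2 (Hu g)).
have uq g : u g \c fmap (T g) q = q \c ephi E' g by rewrite /u; case: cid2.
have iu g : is_iso (u g) by rewrite /u; case: cid2.
have cu g h : u (g * h)%g \c gam T g h Q = u g \c fmap (T g) (u h).
  apply: (coker_epi (equiv_coker (act_equiv T g) (act_add g) (Tq h))).
  rewrite -!hcompA -fmapM gam_nat uq fmapM !hcompA !uq -!hcompA.
  by rewrite ephi_comp.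
have Hq' : q \in equivariant E' (EqvObj iu cu) by apply/equivariantP.
by exists (EqvObj iu cu), (EqvHom Hq').
Qed.

Lemma eqv_ker_preserve (E E' K : eqv_obj) (f : eqv_hom E E') (k : eqv_hom K E) :
  @is_kernel eqv_preadd E E' f K k -> is_kernel (ehom f) (ehom k).
Proof.
move=> Hk; have [K0 [k0 Hk0]] := eqv_ker_lift f.
have [u <- [v [/(congr1 (@ehom _ _)) uv /(congr1 (@ehom _ _)) vu]]] :=
  ker_iso Hk (eqv_ker_reflect Hk0).
by apply: ker_precomp Hk0 _; exists (ehom v).
Qed.

Lemma eqv_coker_preserve (E E' Q : eqv_obj) (f : eqv_hom E E')
    (q : eqv_hom E' Q) :
  @is_cokernel eqv_preadd E E' f Q q -> is_cokernel (ehom f) (ehom q).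
Proof.
move=> Hq; have [Q0 [q0 Hq0]] := eqv_coker_lift f.
have [u <- [v [/(congr1 (@ehom _ _)) uv /(congr1 (@ehom _ _)) vu]]] :=
  coker_iso (eqv_coker_reflect Hq0) Hq.
by apply: coker_postcomp Hq0 _; exists (ehom v).
Qed.

Lemma eqv_mono (E E' : eqv_obj) (f : eqv_hom E E') :
  @monomor eqv_preadd E E' f -> monomor (ehom f).
Proof.
move=> Hf; have [K [k Hk]] := eqv_ker_lift f; apply: mono0 => W h fh.
have [fk Uk] := Hk; have [u [<- _]] := Uk _ _ fh.
have -> : k = 0; last by rewrite hcomp0m.
by apply: (Hf K k 0); apply: ehom_inj; rewrite /= fk hcompm0.
Qed.

Lemma eqv_epi (E E' : eqv_obj) (f : eqv_hom E E') :
  @epimor eqv_preadd E E' f -> epimor (ehom f).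
Proof.
move=> Hf; have [Q [q Hq]] := eqv_coker_lift f; apply: epi0 => W h fh.
have [qf Uq] := Hq; have [u [<- _]] := Uq _ _ fh.
have -> : q = 0; last by rewrite hcompm0.
by apply: (Hf Q q 0); apply: ehom_inj; rewrite /= qf hcomp0m.
Qed.

Lemma eqv_ker_ex (X Y : eqv_preadd) (f : hom X Y) :
  exists (K : eqv_preadd) (k : hom K X), is_kernel f k.
Proof.
by have [K [k Hk]] := eqv_ker_lift f; exists K, k; exact: eqv_ker_reflect.
Qed.

Lemma eqv_coker_ex (X Y : eqv_preadd) (f : hom X Y) :
  exists (Q : eqv_preadd) (q : hom Y Q), is_cokernel f q.
Proof.
by have [Q [q Hq]] := eqv_coker_lift f; exists Q, q; exact: eqv_coker_reflect.
Qed.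

Lemma eqv_mono_normal (X Y : eqv_preadd) (f : hom X Y) :
  monomor f -> exists (Z : eqv_preadd) (g : hom Y Z), is_kernel g f.
Proof.
move=> /eqv_mono/mono_normal[Z [g Hg]]; have [Q [q Hq]] := eqv_coker_lift f.
by exists Q, q; apply: eqv_ker_reflect; exact: ker_coker Hg Hq.
Qed.

Lemma eqv_epi_normal (X Y : eqv_preadd) (f : hom X Y) :
  epimor f -> exists (Z : eqv_preadd) (g : hom Z X), is_cokernel g f.
Proof.
move=> /eqv_epi/epi_normal[Z [g Hg]]; have [K [k Hk]] := eqv_ker_lift f.
by exists K, k; apply: eqv_coker_reflect; exact: coker_ker Hg Hk.
Qed.

Definition eqv : abCat :=
  @AbCat eqv_preadd ebip ebinj ebproj ebprojK ebproj0 ebip_id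
    eqv_ker_ex eqv_coker_ex eqv_mono_normal eqv_epi_normal.

Definition forget : functor eqv A :=
  @Functor eqv A eobj (fun E E' f => ehom f)
    (fun E => erefl) (fun E1 E2 E3 g f => erefl).

(* [T_h T_k X -> T_g X] for [h k = g]: the isomorphism [gam h k], with its
   target rewritten along the equality. *)
Definition gamt (h k g : gT) (e : (h * k)%g = g) (X : A) :
    hom (T h (T k X)) (T g X) := transp T e X \c gam T h k X.

Lemma gamt_iso (h k g : gT) (e : (h * k)%g = g) (X : A) : is_iso (gamt e X).
Proof.
by case: _ / e; rewrite /gamt hcomp1m; exact: gam_iso.
Qed.

Lemma gamt_nat (h k g : gT) (e : (h * k)%g = g) (X Y : A) (f : hom X Y) :
  gamt e Y \c fmap (T h) (fmap (T k) f) = fmap (T g) f \c gamt e X.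
Proof. by case: _ / e; rewrite /gamt !hcomp1m gam_nat. Qed.

Lemma gamt_assoc (g h k gh hk p : gT) (e1 : (g * h)%g = gh) (e2 : (h * k)%g = hk)
    (e3 : (g * hk)%g = p) (e4 : (gh * k)%g = p) (X : A) :
  gamt e3 X \c fmap (T g) (gamt e2 X) = gamt e4 X \c gamt e1 (T k X).
Proof.
case: _ / e1 e4 => e4; case: _ / e2 e3 => e3; case: _ / e4 e3 => e3.
by rewrite /gamt /= !hcomp1m -gam_assoc (eq_irrelevance e3 (mulgA g h k)).
Qed.

Section Induction.
Variable X : A.
Let F (g : gT) : A := T g X.

(* The component [T_h T_(h^-1 g) X -> T_g X] is [gam h (h^-1 g)]. *)
Definition ind_tau (h : gT) : hom (T h (bip F)) (bip F) :=
  \sum_(g : gT) binj F g \c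
    (gamt (mulKVg h g) X \c fmap (T h) (bproj F (h^-1 * g)%g)).

Lemma ind_tauE (h k g : gT) (e : (h * k)%g = g) :
  bproj F g \c ind_tau h = gamt e X \c fmap (T h) (bproj F k).
Proof.
rewrite bproj_binj; have E : k = (h^-1 * g)%g by rewrite -e mulKg.
by subst k; rewrite (eq_irrelevance e (mulKVg h g)).
Qed.

Lemma ind_tau_iso (h : gT) : is_iso (ind_tau h).
Proof.
pose iota k := isoinv (gamt_iso (erefl (h * k)%g) X).
pose s := \sum_(k : gT)
  fmap (T h) (binj F k) \c (iota k \c bproj F (h * k)%g).
have projs k : fmap (T h) (bproj F k) \c s = iota k \c bproj F (h * k)%g.
  rewrite /s hcomp_sumr (bigD1 k) //= big1 => [|j jk].
    by rewrite addr0 hcompA -fmapM bprojK fmap1 hcomp1m.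
  rewrite hcompA -fmapM bproj0 1?eq_sym // fmap0 ?hcomp0m //; exact: act_add.
exists s; split.
  apply: bip_ext => g; rewrite -(mulKVg h g).
  rewrite hcompA (ind_tauE (erefl _)) -hcompA projs hcompA isoinvK.
  by rewrite hcomp1m hcompm1.
rewrite /s hcomp_suml -fmap1 -bip_id fmap_sum; last exact: act_add.
apply: eq_bigr => k _; rewrite -!hcompA (ind_tauE (erefl _)).
by rewrite (hcompA (iota k)) isoKinv hcomp1m fmapM.
Qed.

Lemma ind_tau_comp (h k : gT) :
  ind_tau (h * k)%g \c gam T h k (bip F) = ind_tau h \c fmap (T h) (ind_tau k).
Proof.
apply: bip_ext => g; pose j := (k^-1 * (h^-1 * g))%g.
have e4 : (h * k * j)%g = g by rewrite /j -mulgA !mulKVg.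
have e2 : (k * j)%g = (h^-1 * g)%g by rewrite /j mulKVg.
rewrite !hcompA (ind_tauE e4) (ind_tauE (mulKVg h g)) -!hcompA -fmapM.
rewrite (ind_tauE e2) fmapM -gam_nat !hcompA.
rewrite (gamt_assoc (erefl (h * k)%g) e2 (mulKVg h g) e4).
by rewrite /gamt /= hcomp1m.
Qed.

Definition ind_obj : eqv := @EqvObj (bip F) ind_tau ind_tau_iso ind_tau_comp.

End Induction.

Definition ind_map0 (X Y : A) (f : hom X Y) :
    hom (eobj (ind_obj X)) (eobj (ind_obj Y)) :=
  \sum_(g : gT) binj (fun g => T g Y) g \c
    (fmap (T g) f \c bproj (fun g => T g X) g).

Lemma ind_map0E (X Y : A) (f : hom X Y) (g : gT) :
  bproj (fun g => T g Y) g \c ind_map0 f = fmap (T g) f \c bproj (fun g => T g X) g.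
Proof. exact: (bproj_binj (F := fun g => T g Y)). Qed.

Lemma ind_map_subproof (X Y : A) (f : hom X Y) :
  ind_map0 f \in equivariant (ind_obj X) (ind_obj Y).
Proof.
apply/equivariantP => h; apply: bip_ext => g /=.
rewrite !hcompA ind_map0E (ind_tauE _ (mulKVg h g)) -!hcompA -fmapM ind_map0E.
rewrite (ind_tauE _ (mulKVg h g)) fmapM.
have := congr1 (fun z => z \c fmap (T h) (bproj (fun g => T g X) (h^-1 * g)%g))
  (gamt_nat (mulKVg h g) f).
by rewrite /gamt -!hcompA => ->.
Qed.

Definition ind_map (X Y : A) (f : hom X Y) : eqv_hom (ind_obj X) (ind_obj Y) :=
  EqvHom (ind_map_subproof f).

Lemma ind_map1 (X : A) : ind_map (idm X) = eqv_id (ind_obj X).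
Proof.
apply: ehom_inj; apply: bip_ext => g /=.
by rewrite ind_map0E fmap1 hcomp1m hcompm1.
Qed.

Lemma ind_mapM (X Y Z : A) (g : hom Y Z) (f : hom X Y) :
  ind_map (g \c f) = eqv_comp (ind_map g) (ind_map f).
Proof.
apply: ehom_inj; apply: bip_ext => a /=.
by rewrite hcompA !ind_map0E -hcompA ind_map0E fmapM hcompA.
Qed.

Definition Ind : functor A eqv := @Functor A eqv ind_obj ind_map ind_map1 ind_mapM.

End Equivariantization.

(* A full subcategory is given by its class of objects. *)
Definition serre_subcat (A : abCat) (S : set A) : Prop :=
  [/\ S !=set0,
      forall (I : finType) (F : I -> A), (forall i, S (F i)) -> S (bip F)
    & forall (L M N : A) (f : hom L M) (g : hom M N),
        short_exact f g -> (S M <-> S L /\ S N)].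

Record serre (A : abCat) := Serre {
  sobj : set A;
  sobjP : serre_subcat sobj
}.

Lemma serre_dsum (A : abCat) (P : serre A) (X Y : A) :
  sobj P (dsum X Y) <-> sobj P X /\ sobj P Y.
Proof.
have [_ _ H] := sobjP P; have [f [g Hfg]] := dsum_short_exact X Y.
exact: H Hfg.
Qed.

Definition G_invariant (gT : finGroupType) (A : abCat) (T : gaction gT A)
    (S : set A) : Prop :=
  forall (g : gT) (X : A), S X -> S (T g X).

Section SerreEquivariant.
Variables (gT : finGroupType) (A : abCat) (T : gaction gT A).

Definition eqv_sub (S : set A) : set (eqv T) := [set E | S (eobj E)].

Lemma eqv_sub_serre (S : serre A) : serre_subcat (eqv_sub (sobj S)).
Proof.
case: S => S [[X SX] Sbip Sex]; split=> /=.
- exists (bip (fun v : void => of_void (eqv T) v)).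
  by apply: Sbip; case.
- by move=> I F SF; apply: Sbip.
- move=> L M N f g [/eqv_ker_preserve Hk /eqv_coker_preserve Hc].
  exact: (Sex _ _ _ (ehom f) (ehom g)).
Qed.

Definition serreG (S : serre A) : serre (eqv T) := Serre (eqv_sub_serre S).

End SerreEquivariant.

Record Esp (A : abCat) (C : set (serre A)) := EspPt {
  esp_val : serre A;
  esp_mem : C esp_val
}.

Section EspTopology.
Variables (A : abCat) (C : set (serre A)).

Definition esp_closed (X : set A) : set (Esp C) :=
  [set P | sobj (esp_val P) `&` X = set0].

Definition esp_open : set_system (Esp C) :=
  [set U | exists X : set A, ~` U = esp_closed X].

Lemma esp_openP (U : set (Esp C)) :
  esp_open U <-> exists X : set A, U = [set P | sobj (esp_val P) `&` X !=set0].
Proof.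
have K X : ~` esp_closed X = [set P | sobj (esp_val P) `&` X !=set0].
  by apply/seteqP; split=> P /= => [/eqP/set0P|/set0P/eqP].
by split=> -[X E]; exists X; rewrite ?E -K ?setCK // -E setCK.
Qed.

Lemma esp_openT : esp_open setT.
Proof.
apply/esp_openP; exists setT; apply/seteqP; split=> // P _ /=.
by rewrite setIT; case: (sobjP (esp_val P)).
Qed.

Lemma esp_openI : setI_closed esp_open.
Proof.
move=> U V /esp_openP[X ->] /esp_openP[Y ->]; apply/esp_openP.
exists [set Z | exists x y, [/\ X x, Y y & Z = dsum x y]].
apply/seteqP; split=> P /=.
  move=> [[x [Px Xx]] [y [Py Yy]]]; exists (dsum x y); split; last by exists x, y.
  by apply/serre_dsum.
move=> [z [Pz [x [y [Xx Yy zE]]]]].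
have [Px Py] : sobj (esp_val P) x /\ sobj (esp_val P) y.
  by apply/serre_dsum; rewrite -zE.
by split; [exists x | exists y].
Qed.

Lemma esp_open_bigU (I : Type) (f : I -> set (Esp C)) :
  (forall i, esp_open (f i)) -> esp_open (\bigcup_i f i).
Proof.
move=> Hf; have {}Hf i := (esp_openP (f i)).1 (Hf i).
have [X HX] := choice Hf.
apply/esp_openP; exists (\bigcup_i X i); apply/seteqP; split=> P /=.
  by move=> [i _]; rewrite HX /= => -[x [Px Xx]]; exists x; split=> //; exists i.
by move=> [x [Px [i _ Xx]]]; exists i => //; rewrite HX /=; exists x.
Qed.

HB.instance Definition _ := gen_eqMixin (Esp C).
HB.instance Definition _ := gen_choiceMixin (Esp C).
HB.instance Definition _ :=
  isOpenTopological.Build (Esp C) esp_openT esp_openI esp_open_bigU.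

Lemma esp_closedE (F : set (Esp C)) :
  closed F <-> exists X : set A, F = esp_closed X.
Proof.
by rewrite -openC; split=> -[X]; rewrite ?setCK => E; exists X; rewrite ?setCK.
Qed.

End EspTopology.

Definition EspSerre (A : abCat) := Esp [set: serre A].

Definition Esp_incl (A : abCat) (C : set (serre A)) (P : Esp C) : EspSerre A :=
  EspPt (I : [set: serre A] (esp_val P)).

Definition Esp_map (A B : abCat) (C : set (serre A)) (f : serre A -> serre B)
    (P : Esp C) : Esp (f @` C) :=
  EspPt (imageP f (esp_mem P)).

Definition homeomorphism (X Y : topologicalType) (f : X -> Y) : Prop :=
  continuous f /\
  exists g : Y -> X, [/\ continuous g, cancel f g & cancel g f].

(* [set_type (range f)] carries the subspace topology. *)
Definition onto_image (X Y : Type) (f : X -> Y) (x : X) : set_type (range f) :=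
  exist _ (f x) (mem_set (imageT f x)).

Definition immersion (X Y : topologicalType) (f : X -> Y) : Prop :=
  homeomorphism (onto_image f).

(* Main.v *)
(* For a G-invariant S, an object X of A lies in S iff Ind X lies in S^G: the
   object Ind X is the sum of the T_g X, and X embeds in it through T_1 X. So
   S |-> S^G is injective, the basic open set of a class X of A corresponds to
   that of Ind X, and conversely that of a class of A^G to that of its image
   under the forgetful functor. *)
Require Import Defs.
From mathcomp Require Import all_boot all_order all_algebra all_fingroup.
From mathcomp Require Import all_classical.
From mathcomp Require Import topology.

Set Implicit Arguments.
Unset Strict Implicit.
Unset Printing Implicit Defensive.

Local Open Scope classical_set_scope.

Section Inducing.
Implicit Types X Y Z : topologicalType.

(** [X] carries the initial topology along [f]. Stated on open sets, the condition composes, and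
    with injectivity it yields an immersion. *)
Definition inducing X Y (f : X -> Y) : Prop :=
  forall U : set X, open U <-> exists2 V : set Y, open V & f @^-1` V = U.

Lemma inducing_comp X Y Z (g : Y -> Z) (f : X -> Y) :
  inducing g -> inducing f -> inducing (g \o f).
Proof.
move=> ig jf U; split=> [/jf[V /ig[W oW <-] <-]|[W oW <-]]; first by exists W.
by apply/jf; exists (g @^-1` W) => //; apply/ig; exists W.
Qed.

Lemma inducing_homeomorphism X Y (f : X -> Y) :
  inducing f -> bijective f -> homeomorphism f.
Proof.
move=> jf [g fK gK]; split; first by apply/continuousP => V oV; apply/jf; exists V.
(* An open set of [X] is [f @^-1] of some open [V]; pulling it back along the inverse [g] returns
   [V]. *)
exists g; split=> //; apply/continuousP => U /jf[V oV <-].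
by rewrite -comp_preimage (_ : f \o g = id) //; apply/funext => y /=; rewrite gK.
Qed.

Lemma inducing_immersion X Y (f : X -> Y) :
  inducing f -> injective f -> immersion f.
Proof.
move=> jf injf; apply: inducing_homeomorphism.
  (* Open sets of the range are traces of open sets of [Y], so corestricting [f] to its range keeps
     it inducing. *)
  move=> U; split=> [/jf[V oV <-]|[_ [V oV <-] <-]]; last by apply/jf; exists V.
  by exists (set_val @^-1` V) => //; exists V.
have fP (y : set_type (range f)) : exists x, onto_image f x = y.
  by have /set_mem[x _ fx] := valP y; exists x; apply/val_inj.
have [g gP] := choice fP.
by exists g => // x; apply: injf; have /(congr1 sval) := gP (onto_image f x).
Qed.

End Inducing.

Section Serre.
Variable A : abCat.

Lemma serre_ext (S S' : serre A) : sobj S = sobj S' -> S = S'.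
Proof.
by case: S S' => [S HS] [S' HS'] /= E; subst S'; rewrite (Prop_irrelevance HS HS').
Qed.

Lemma esp_val_inj (C : set (serre A)) : injective (@esp_val A C).
Proof.
by move=> [S CS] [S' CS'] /= E; subst S'; rewrite (Prop_irrelevance CS CS').
Qed.

(** A monomorphism is a kernel, hence the kernel of its own cokernel, so it starts a short exact
    sequence with [M] in the middle. *)
Lemma serre_mono (S : serre A) (L M : A) (f : Defs.hom L M) :
  monomor f -> sobj S M -> sobj S L.
Proof.
move=> mf SM; have [Z [g Hg]] := mono_normal mf; have [Q [q Hq]] := coker_ex f.
have [_ _ H] := sobjP S.
by have [] := (H _ _ _ f q (conj (ker_coker Hg Hq) Hq)).1 SM.
Qed.

Lemma binj_mono (I : finType) (F : I -> A) (i : I) : monomor (binj F i).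
Proof.
move=> W h h' E.
by rewrite -[h]hcomp1m -[h']hcomp1m -(bprojK F i) -!hcompA E.
Qed.

Lemma serre_bip (S : serre A) (I : finType) (F : I -> A) :
  sobj S (bip F) <-> forall i, sobj S (F i).
Proof.
split=> [SF i|]; first exact: serre_mono (@binj_mono I F i) SF.
by have [_ H _] := sobjP S; exact: H.
Qed.

End Serre.

Section Invariant.
Variables (gT : finGroupType) (A : abCat) (T : gaction gT A).

(* Write X as T_1 V up to isomorphism, and use T_1 T_1 V = T_1 V. *)
Lemma serre_act1 (S : serre A) (X : A) : sobj S (T 1%g X) -> sobj S X.
Proof.
have [V [e He]] := equiv_surj (act_equiv T 1%g) X.
have [e' [ee' e'e]] := He.
have me' : monomor e' by apply: iso_mono; exists e.
have g11 := gamt_iso T (mulg1 1%g) V.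
have mg : monomor (isoinv g11).
  by apply: iso_mono; exists (gamt T (mulg1 1%g) V); rewrite isoinvK isoKinv.
(* The data of an action include no isomorphism between [X] and [T 1 X]; the monomorphisms from [X]
   to [T 1 V], to [T 1 (T 1 V)], to [T 1 X] take its place. *)
move=> ST; apply: (serre_mono me'); apply: (serre_mono mg).
apply: serre_mono (iso_mono (fmap_iso (T 1%g) He)) ST.
Qed.

Lemma serreG_Ind (S : serre A) : G_invariant T (sobj S) ->
  forall X : A, sobj (serreG T S) (Ind T X) <-> sobj S X.
Proof.
move=> GS X; have bipP := serre_bip S (fun g => T g X).
split=> [SX|SX]; first by apply: serre_act1; exact: (bipP.1 SX).
by apply/bipP => g; exact: GS.
Qed.

(** An invariant [S] is recovered from [serreG T S] as the class of all [X] whose [Ind T X] lies in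
    it. *)
Lemma serreG_inj (S S' : serre A) :
  G_invariant T (sobj S) -> G_invariant T (sobj S') ->
  serreG T S = serreG T S' -> S = S'.
Proof.
move=> GS GS' E; apply/serre_ext/funext => X; apply/propext.
by rewrite -(serreG_Ind GS) E serreG_Ind.
Qed.

End Invariant.

Lemma Esp_incl_inj (A : abCat) (C : set (serre A)) : injective (@Esp_incl A C).
Proof. by move=> P Q [E]; apply: esp_val_inj. Qed.

(** One class of objects defines an open set in both spaces, and the smaller one is the trace of the
    larger. *)
Lemma Esp_incl_inducing (A : abCat) (C : set (serre A)) :
  inducing (@Esp_incl A C).
Proof.
move=> U; split=> [/esp_openP[X ->]|[V /esp_openP[X ->] <-]].
  by exists [set P | sobj (esp_val P) `&` X !=set0] => //; apply/esp_openP; exists X.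
by apply/esp_openP; exists X.
Qed.

Section EspMap.
Variables (gT : finGroupType) (A : abCat) (T : gaction gT A).
Let C : set (serre A) := [set S | G_invariant T (sobj S)].
Let Phi : Esp C -> Esp (serreG T @` C) := Esp_map (serreG T).

Lemma Esp_map_serreG_bij : bijective Phi.
Proof.
have injPhi : injective Phi.
  move=> P Q /(congr1 (@esp_val _ _)) E; apply: esp_val_inj.
  exact: serreG_inj (esp_mem P) (esp_mem Q) E.
have PhiP (Q : Esp (serreG T @` C)) : exists P, Phi P = Q.
  (* The codomain is indexed by the image of [C], so each point carries its own preimage. *)
  by have [S CS E] := esp_mem Q; exists (EspPt CS); apply: esp_val_inj.
have [g gP] := choice PhiP.
by exists g => // P; apply: injPhi; rewrite gP.
Qed.

Lemma Esp_map_serreG_inducing : inducing Phi.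
Proof.
move=> U; split=> [/esp_openP[X ->]|[V /esp_openP[Y ->] <-]].
  exists [set P | sobj (esp_val P) `&` Ind T @` X !=set0].
    by apply/esp_openP; exists (Ind T @` X).
  apply/seteqP; split=> P /=.
    move=> [E [PE [x Xx xE]]]; exists x; split=> //.
    by apply/(serreG_Ind (esp_mem P)); move: PE; rewrite -xE.
  move=> [x [Px Xx]]; exists (Ind T x); split; last by exists x.
  exact: (serreG_Ind (esp_mem P) x).2.
(* Membership in [serreG T S] depends on the underlying object alone, so meeting [Y] upstairs means
   meeting its image under [forget T]. *)
apply/esp_openP; exists (forget T @` Y); apply/seteqP; split=> P /=.
  by move=> [E [PE YE]]; exists (forget T E); split=> //; exists E.
by move=> [Z [PZ [E YE EZ]]]; exists E; split=> //; move: PZ; rewrite -EZ.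
Qed.

End EspMap.

Theorem corollary6p20 (gT : finGroupType) (A : abCat) (T : gaction gT A)
    (Ind_exact : exact_functor (Ind T))
    (forget_exact : exact_functor (forget T))
    (Ind_forget : adjoint (Ind T) (forget T))
    (forget_Ind : adjoint (forget T) (Ind T))
    (summand_Ind : forall E : eqv T, direct_summand E (Ind T (forget T E))) :
  let C : set (serre A) := [set S | G_invariant T (sobj S)] in
  let CG : set (serre (eqv T)) := serreG T @` C in
  let Phi : Esp C -> Esp CG := Esp_map (serreG T) in
  let incl : Esp CG -> EspSerre (eqv T) := @Esp_incl (eqv T) CG in
  [/\ homeomorphism Phi, immersion incl & immersion (incl \o Phi)].
Proof.
move=> C CG Phi incl.
have bPhi : bijective Phi := Esp_map_serreG_bij T.
have jPhi : inducing Phi := @Esp_map_serreG_inducing _ _ T.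
have injincl : injective incl := @Esp_incl_inj _ CG.
have jincl : inducing incl := @Esp_incl_inducing _ CG.
split.
- exact: inducing_homeomorphism.
- exact: inducing_immersion.
- by apply: inducing_immersion; [exact: inducing_comp|exact: inj_comp (bij_inj bPhi)].
Qed.
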